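(* Let $\Sigma$ be a totally ordered alphabet with $|\Sigma| > n$. Any read-once branching program that, on every input sequence $x \in \Sigma^n$, computes $\mathrm{LIS}(x)$ has size $2^{\Omega(n)}$.
   Context: For $x = x_1 \cdots x_n \in \Sigma^n$, $\mathrm{LIS}(x)$ denotes the length of a longest strictly increasing subsequence of $x$. A $|\Sigma|$-way branching program on inputs $x \in \Sigma^n$ is a directed acyclic rooted graph in which each non-sink node is labelled by an index $i \in [n]$ and has one out-edge for each symbol of $\Sigma$; on input $x$, computation starts at the root and at a node labelled $i$ follows the out-edge labelled $x_i$ (the program ''queries'' $x_i$), until reaching a sink, whose label is the output. The size is the number of nodes. It is read-once if along every computation path each index $i$ is queried at most once. *)

(* Defs.v *)
From Stdlib Require Import Relation_Operators.
From mathcomp Require Import all_boot all_order.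

Set Implicit Arguments.
Unset Strict Implicit.
Unset Printing Implicit Defensive.

(* A mask m selects the subsequence of the entries at the positions where m is
   true. *)
Definition LIS (d : Order.disp_t) (Sigma : orderType d) (n : nat)
    (x : n.-tuple Sigma) : nat :=
  \max_(m : n.-tuple bool | sorted <%O (mask m x)) size (mask m x).

(* The alphabet may be infinite, so |Sigma| > n is not stated through #|_|. *)
Definition has_more_than (n : nat) (Sigma : eqType) : Prop :=
  exists s : seq Sigma, uniq s /\ n < size s.

(* The out-edges of a query node are given by a function on the alphabet, so
   that parallel edges are allowed; a sink carries an output and no edge. *)
Variant bp_instr (Sigma : Type) (n : nat) (Out V : Type) : Type :=
  | Query (i : 'I_n) (succ : Sigma -> V)
  | Sink (out : Out).
Arguments Query {Sigma n Out V} i succ.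
Arguments Sink {Sigma n Out V} out.

Definition bp_edge (Sigma : Type) (n : nat) (Out V : Type)
    (instr : V -> bp_instr Sigma n Out V) (u v : V) : Prop :=
  match instr u with
  | Query _ succ => exists a : Sigma, succ a = v
  | Sink _ => False
  end.

Record bprog (Sigma : Type) (n : nat) (Out : Type) : Type := BProg {
  bp_node : finType;
  bp_root : bp_node;
  bp_code : bp_node -> bp_instr Sigma n Out bp_node;
  bp_acyclic : forall u : bp_node, ~ clos_trans bp_node (bp_edge bp_code) u u
}.

Definition bp_size (Sigma : Type) (n : nat) (Out : Type)
    (B : bprog Sigma n Out) : nat := #|bp_node B|.

(* computation B x u q a: on input x, the path starting at node u queries
   exactly the indices listed in q, in this order, and ends in a sink
   labelled a. *)
Inductive computation (Sigma : Type) (n : nat) (Out : Type)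
    (B : bprog Sigma n Out) (x : n.-tuple Sigma) :
    bp_node B -> seq 'I_n -> Out -> Prop :=
  | computation_sink u a :
      bp_code u = Sink a -> computation x u [::] a
  | computation_query u i succ q a :
      bp_code u = Query i succ ->
      computation x (succ (tnth x i)) q a ->
      computation x u (i :: q) a.

Definition bp_computes (Sigma : Type) (n : nat) (Out : Type)
    (B : bprog Sigma n Out) (f : n.-tuple Sigma -> Out) : Prop :=
  forall x : n.-tuple Sigma, exists q, computation x (bp_root B) q (f x).

(* Only paths followed by some input are constrained.  Over a nonempty alphabet
   this is equivalent to constraining all paths from the root: up to its first
   repeated query, any such path is followed by some input. *)
Definition read_once (Sigma : Type) (n : nat) (Out : Type)
    (B : bprog Sigma n Out) : Prop :=
  forall (x : n.-tuple Sigma) q a, computation x (bp_root B) q a -> uniq q.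

(* Main.v *)
(* Let m = n/2 and k = m/4, identify an increasing chain of n+1 letters with
   0, ..., n, and feed the program the 2^m inputs with x_l in {2l+1, 2l+2} for
   l < m and x_l = 0 for l >= m.  Call the positions l < m active.  The key fact
   is that if a set U of at most m/2 active positions contains i, then the
   active positions outside U can be filled so that LIS depends on x_U only
   through x_i, and does depend on it: either some interval ]i, r] contains more
   positions outside U than inside, and for the shortest such interval we put
   2i+2, 2i+3, ... on its positions outside U, which can all be taken in an
   increasing subsequence through i only when x_i = 2i+1; or the mirror image
   applies.  Hence each of the 2^m inputs makes the program query at least k
   active positions, and two inputs that are at the same node after k active
   queries agree on the active positions queried by either: otherwise take for
   U the union of the two query sets, complete both partial inputs so that they
   differ at such a position, and note that beyond that node neither
   computation can query U again.  So a node serves at most 2^(m-k) inputs, and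
   there are at least 2^k nodes. *)
Require Import Defs.
From mathcomp Require Import all_boot all_order all_algebra.
From mathcomp Require Import reals exp.
From mathcomp Require Import zify.

Set Implicit Arguments.
Unset Strict Implicit.
Unset Printing Implicit Defensive.
Import Order.TTheory GRing.Theory Num.Theory.

(** * Increasing subsequences as chains of positions *)

Definition chain_rel (X : nat -> nat) : rel nat :=
  fun p q => (p < q) && (X p < X q).

Lemma chain_rel_trans X : transitive (chain_rel X).
Proof. by move=> y x z; rewrite /chain_rel; lia. Qed.

(** A threshold form of LIS on plain functions, so that reversal and truncation need no tuples. *)
Definition has_inc (m : nat) (X : nat -> nat) (L : nat) : Prop :=
  exists T, [/\ all (fun p => p < m) T, sorted (chain_rel X) T & L <= size T].

(** Each label class is a nonincreasing chain, so an increasing subsequence meets it at most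
    once. *)
Lemma has_inc_label_le m X L h k :
  (forall p q, p < q -> q < m -> X p < X q -> h p <> h q) ->
  (forall p, p < m -> h p < L) -> has_inc m X k -> k <= L.
Proof.
move=> hinj hL [T [Tm Ts /leq_trans]]; apply.
rewrite -(size_map h) -[X in _ <= X](size_iota 0); apply: uniq_leq_size.
  rewrite uniq_pairwise pairwise_map.
  move: Ts; rewrite (sorted_pairwise (@chain_rel_trans X)).
  apply: (sub_in_pairwise (P := fun p => p < m)) => // p q pm qm /andP[pq Xpq].
  by apply/eqP; apply: hinj.
move=> _ /mapP[p /(allP Tm) pm ->]; rewrite mem_iota /=; exact: hL.
Qed.

(** Reversing positions and complementing values each flip the order, so together they preserve
    chains. The bound [M] keeps the truncated subtraction strictly decreasing. *)
Lemma has_inc_rev m X L (M : nat) :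
  (forall p, p < m -> X p <= M) ->
  has_inc m X L -> has_inc m (fun p => M - X (m.-1 - p)) L.
Proof.
move=> XM [T [Tm Ts LT]]; exists (rev (map (fun p => m.-1 - p) T)); split.
- by rewrite all_rev all_map; apply: sub_all Tm => p /=; lia.
- rewrite rev_sorted sorted_map.
  move: Ts; apply: (sub_in_sorted (P := fun p => p < m)) => //.
  move=> p q; rewrite -!topredE /chain_rel /= => pm qm /andP[pq Xpq].
  have -> : m.-1 - (m.-1 - p) = p by lia.
  have -> : m.-1 - (m.-1 - q) = q by lia.
  have := XM _ qm; have := XM _ pm; lia.
- by rewrite size_rev size_map.
Qed.

Lemma eq_has_inc m X Y L :
  (forall p, p < m -> X p = Y p) -> has_inc m X L -> has_inc m Y L.
Proof.
move=> XY [T [Tm Ts LT]]; exists T; split=> //.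
move: Ts; apply: (sub_in_sorted (P := fun p => p < m)) => // p q pm qm.
by rewrite /chain_rel !XY.
Qed.

(** * Counting positions, and fillings that isolate one letter *)

Definition cnt (P : pred nat) p := count P (iota 0 p).

Lemma cntS P p : cnt P p.+1 = cnt P p + P p.
Proof. by rewrite /cnt -addn1 iotaD count_cat /= addn0. Qed.

Lemma cnt_homo (P : pred nat) p q :
  p <= q -> cnt P p <= cnt P q <= cnt P p + (q - p).
Proof.
elim: q => [|q IH]; first by rewrite leqn0 => /eqP ->; rewrite addn0 leqnn.
rewrite leq_eqVlt => /orP[/eqP -> |]; first by rewrite subnn addn0 leqnn.
move=> pq; have := IH pq; rewrite cntS; case: (P q); lia.
Qed.

Lemma cnt_ltS (P : pred nat) p q : P p -> p < q -> cnt P p < cnt P q.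
Proof. by move=> Pp pq; have := cnt_homo P pq; rewrite cntS Pp; lia. Qed.

Lemma cnt_ltN (P : pred nat) p q : ~~ P p -> p < q -> cnt P q - cnt P p < q - p.
Proof.
by move=> /negbTE Pp pq; have := cnt_homo P pq; rewrite cntS Pp; lia.
Qed.

Lemma cnt_le (P : pred nat) p : cnt P p <= p.
Proof. by have := cnt_homo P (leq0n p); rewrite /cnt /=; lia. Qed.

(* Position [p] outside [S] is matched with the position of [S] having the
   same label, which precedes it by the ballot condition and carries a larger
   or equal value: this covers everything by [cnt S m] nonincreasing chains. *)
Lemma has_inc_ballot (m i r : nat) (S : pred nat) (X : nat -> nat) :
  i < r -> r < m ->
  (forall p, p <= i -> S p) -> ~~ S r -> (forall p, r < p -> S p) ->
  (forall p, i < p -> p <= r -> p + i.+1 <= (cnt S p).*2) ->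
  r + i.+1 = (cnt S r).*2 ->
  (forall p, p < m -> S p -> X p = p.*2.+1 \/ X p = p.*2.+2) ->
  (forall p, p < m -> ~~ S p -> X p = i.*2.+2 + (p - cnt S p)) ->
  has_inc m X (cnt S m).+1 <-> X i = i.*2.+1.
Proof.
move=> ir rm Si Sr Sr' bal balr XS XW.
have cSi p : p <= i.+1 -> cnt S p = p.
  elim: p => // p IH pi; rewrite cntS IH ?(ltnW pi) // Si //; lia.
have im : i < m by lia.
have cSr p : r < p -> cnt S p = cnt S r + (p - r.+1).
  elim: p => // p IH; rewrite ltnS leq_eqVlt => /orP[/eqP <-|rp].
    by rewrite cntS (negbTE Sr); lia.
  by rewrite cntS IH // Sr' //; lia.
have WI p : ~~ S p -> i < p.
  by move=> Sp; rewrite ltnNge; apply/negP => /Si; rewrite (negbTE Sp).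
have WR p : ~~ S p -> p <= r.
  by move=> Sp; rewrite leqNgt; apply/negP => /Sr'; rewrite (negbTE Sp).
split=> [inc|Xi].
  case: (XS i im (Si _ (leqnn _))) => // Xi; exfalso.
  suff: (cnt S m).+1 <= cnt S m by rewrite ltnn.
  apply: (has_inc_label_le
    (h := fun p => if S p then cnt S p else i + (p - cnt S p))) inc.
    move=> p q pq qm Xpq; have pm : p < m by lia.
    case: ifPn => Sp; case: ifPn => Sq.
    - by have := cnt_ltS Sp pq; lia.
    - have := WI _ Sq => iq; have := WR _ Sq => qr.
      move: Xpq; rewrite (XW _ qm Sq) => Xpq e.
      have := bal _ iq qr; have := cnt_le S q; have := cnt_le S p => cp cq bq.
      have ip : i <= p by rewrite leqNgt; apply/negP => pi; move: (cSi p); lia.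
      (* Here [X i = 2i+2] enters: a position outside [S] with label [i] also carries [2i+2], so it
         cannot follow [i] in a chain. *)
      case: (eqVneq p i) => [pi|pi]; first by move: Xpq; rewrite pi Xi; lia.
      have : i.+1 <= p by lia.
      move=> /(cnt_homo S); rewrite (cSi i.+1) // => ci.
      case: (XS p pm Sp) => E; lia.
    - have := bal _ (WI _ Sp) (WR _ Sp) => bp.
      have := cnt_homo S (ltnW pq); have := cnt_le S p; lia.
    - have := cnt_ltN Sp pq; have := cnt_homo S (ltnW pq).
      have := cnt_le S p; have := cnt_le S q; lia.
  move=> p pm; case: ifPn => Sp; first exact: cnt_ltS.
  have := cnt_ltN Sp (WR _ Sp : p < r.+1); have := cSr _ rm.
  have := cnt_homo S (WR _ Sp); have := cnt_le S p; have := cnt_le S r.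
  lia.
(* The long chain drops the positions of [S] in []i, r]]; by the balance at [r] it has exactly
   [cnt S m + 1] positions. *)
pose G p := [|| ~~ S p, p <= i | r < p].
exists (filter G (iota 0 m)); split.
- by apply/allP => p; rewrite mem_filter mem_iota => /andP[_]; lia.
- rewrite (sorted_pairwise (@chain_rel_trans X)).
  have : pairwise ltn (filter G (iota 0 m)).
    rewrite -(sorted_pairwise ltn_trans).
    by apply: sorted_filter (iota_ltn_sorted 0 m); exact: ltn_trans.
  apply: (sub_in_pairwise (P := fun p => (p < m) && G p)); last first.
    by apply/allP => p; rewrite mem_filter mem_iota /=; lia.
  move=> p q /andP[pm Gp] /andP[qm Gq] pq; have {}pq : p < q := pq.
  rewrite /chain_rel pq /=.
  case: (boolP (S p)) => Sp; case: (boolP (S q)) => Sq.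
  + by case: (XS _ pm Sp); case: (XS _ qm Sq); lia.
  + rewrite (XW _ qm Sq).
    have pi : p <= i by have := WR _ Sq; move: Gp; rewrite /G Sp /=; lia.
    case: (eqVneq p i) => [-> | pi']; first by rewrite Xi; lia.
    by case: (XS _ pm Sp); lia.
  + rewrite (XW _ pm Sp).
    have rq : r < q by have := WI _ Sp; move: Gq; rewrite /G Sq /=; lia.
    have : cnt S i.+1 <= cnt S p by have /andP[] := cnt_homo S (WI _ Sp).
    rewrite cSi // => ip; have := WR _ Sp.
    by case: (XS _ qm Sq); lia.
  + rewrite (XW _ pm Sp) (XW _ qm Sq).
    have := cnt_ltN Sp pq; have := cnt_homo S (ltnW pq).
    have := cnt_le S p; have := cnt_le S q; lia.
- rewrite size_filter -/(cnt G m).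
  have G1 p : p <= i.+1 -> cnt G p = p.
    by elim: p => // p IH pi; rewrite cntS IH ?(ltnW pi) // /G; lia.
  have G2 p : i < p -> p <= r.+1 -> cnt G p = i.+1 + (p - cnt S p).
    elim: p => // p IH; rewrite ltnS leq_eqVlt => /orP[/eqP <- _|ip pr].
      by rewrite G1 // cSi // subnn addn0.
    rewrite cntS IH ?(ltnW pr) // cntS /G; have := cnt_le S p.
    case: (S p) => /=; lia.
  have G3 p : r < p -> cnt G p = i.+1 + (r.+1 - cnt S r) + (p - r.+1).
    elim: p => // p IH; rewrite ltnS leq_eqVlt => /orP[/eqP <-|rp].
      rewrite G2 //; last by lia.
      by rewrite (cSr r.+1) //; lia.
    by rewrite cntS IH // /G rp !orbT; lia.
  rewrite G3 // (cSr m) //; have := cnt_le S r; lia.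
Qed.

(** Take the shortest []i, r]] with a majority outside [U]: minimality is the ballot condition.
    Positions outside this interval are added to [S], those not in [U] being frozen at [2p+1].
    Positivity of [w] serves the mirror image in [detect]. *)
Lemma detect_right m (U : pred nat) i :
  i < m -> U i -> (cnt U m - cnt U i.+1).*2 < m - i.+1 ->
  exists w L, (forall p, p < m -> 0 < w p <= m.*2) /\
    forall X, (forall p, p < m -> U p -> X p = p.*2.+1 \/ X p = p.*2.+2) ->
              (forall p, p < m -> ~~ U p -> X p = w p) ->
              has_inc m X L <-> X i = i.*2.+1.
Proof.
move=> im Ui Um.
have exr : exists r, (i < r) && ((cnt U r.+1 - cnt U i.+1).*2 < r - i).
  by exists m.-1; rewrite prednK; lia.
case: (ex_minnP exr) => r /andP[ir Ur] rmin.
have rm : r < m.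
  suff: r <= m.-1 by lia.
  by apply: rmin; rewrite prednK; lia.
pose S p := [|| p <= i, r < p | U p].
have cSi p : p <= i.+1 -> cnt S p = p.
  by elim: p => // p IH pi; rewrite cntS IH ?(ltnW pi) // /S; lia.
have cS p : i < p -> p <= r.+1 -> cnt S p = i.+1 + (cnt U p - cnt U i.+1).
  elim: p => // p IH; rewrite ltnS leq_eqVlt => /orP[/eqP <- _|ip pr].
    by rewrite cSi // subnn addn0.
  rewrite cntS IH ?(ltnW pr) // (cntS U p) /S.
  have /andP[] := cnt_homo U ip; case: (U p); lia.
have bal p : i < p -> p <= r -> p + i.+1 <= (cnt S p).*2.
  move=> ip pr; rewrite cS; [|lia..].
  case: (eqVneq p i.+1) => [->|pi]; first by lia.
  have := rmin p.-1; rewrite prednK; last lia.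
  case: (ltnP (cnt U p - cnt U i.+1).*2 (p.-1 - i)) => H.
    rewrite (_ : i < p.-1); last lia.
    move=> /(_ isT); lia.
  by move=> _; lia.
(* The ballot bound at [r] and the strict majority on []i, r]] leave no slack. *)
have nUr : ~~ U r /\ r + i.+1 = (cnt S r).*2.
  have := bal r ir (leqnn _); rewrite cS ?leqnSn //.
  have := cnt_homo U ir.
  move: Ur; rewrite cntS; case: (U r) => /=; lia.
pose w p := if S p then p.*2.+1 else i.*2.+2 + (p - cnt S p).
exists w, (cnt S m).+1; split=> [p pm|X XU Xw].
  rewrite /w; case: ifPn => Sp; first lia.
  have ip : i < p by move: Sp; rewrite /S; lia.
  have /andP[] := cnt_homo S ip; rewrite cSi //; lia.
apply: (has_inc_ballot ir rm) => //.
- by move=> p pi; rewrite /S pi.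
- by rewrite /S (negbTE nUr.1); lia.
- by move=> p rp; rewrite /S rp orbT.
- exact: nUr.2.
- move=> p pm Sp; case: (boolP (U p)) => Up; first exact: XU.
  by left; rewrite Xw // /w Sp.
- move=> p pm Sp; rewrite Xw /w ?(negbTE Sp) //.
  by apply: contraNN Sp => Up; rewrite /S Up !orbT.
Qed.

Lemma cnt_rev (U : pred nat) m k :
  k <= m -> cnt (fun p => U (m.-1 - p)) k = cnt U m - cnt U (m - k).
Proof.
elim: k => [|k IH] km; first by rewrite subn0 subnn.
rewrite cntS IH ?(ltnW km) //.
have e : m - k = (m - k.+1).+1 by lia.
have e' : m.-1 - k = m - k.+1 by lia.
rewrite e e' cntS; have : (m - k.+1).+1 <= m by lia.
move=> /(cnt_homo U); rewrite cntS; case: (U _); lia.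
Qed.

(* If position [i] failed both on the right and, after reversal, on the left,
   then at least half of the other positions would be in [U]. *)
Lemma detect m (U : pred nat) i :
  i < m -> U i -> (cnt U m).*2 <= m ->
  exists w L (e : bool), (forall p, p < m -> w p <= m.*2) /\
    forall X, (forall p, p < m -> U p -> X p = p.*2.+1 \/ X p = p.*2.+2) ->
              (forall p, p < m -> ~~ U p -> X p = w p) ->
              has_inc m X L <-> X i = (e + i.*2).+1.
Proof.
move=> im Ui Um.
case: (ltnP (cnt U m - cnt U i.+1).*2 (m - i.+1)) => [right|left].
  have [w [L [wm H]]] := detect_right im Ui right.
  by exists w, L, false; split=> // p /wm /andP[].
pose rev p := m.-1 - p.
have revK p : p < m -> rev (rev p) = p by rewrite /rev; lia.
have revm p : p < m -> rev p < m by rewrite /rev; lia.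
pose U' p := U (rev p).
have U'i : U' (rev i) by rewrite /U' revK.
have U'm : (cnt U' m - cnt U' (rev i).+1).*2 < m - (rev i).+1.
  rewrite !cnt_rev //; last by rewrite /rev; lia.
  have -> : m - (rev i).+1 = i by rewrite /rev; lia.
  rewrite subnn [cnt U 0]/= subn0; have := cnt_homo U (ltnW im).
  have := cnt_homo U im; move: left; rewrite cntS Ui; lia.
have [w [L [wm H]]] := detect_right (revm _ im) U'i U'm.
(* Complementing to [2m+1] swaps the two letters of a position with those of its mirror image, hence
   [e = true]. *)
exists (fun p => m.*2.+1 - w (rev p)), L, true; split=> [p /revm /wm|X XU Xw].
  by lia.
have XM p : p < m -> X p <= m.*2.+1.
  move=> pm; case: (boolP (U p)) => Up; first by case: (XU _ pm Up); lia.
  by rewrite Xw // leq_subr.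
pose X' p := m.*2.+1 - X (rev p).
have : has_inc m X' L <-> X' (rev i) = (rev i).*2.+1.
  apply: H => p pm Up.
    by rewrite /X'; case: (XU _ (revm _ pm) Up) => ->; rewrite /rev; lia.
  rewrite /X' Xw ?revm // revK //; have := wm _ pm; lia.
have -> : has_inc m X' L <-> has_inc m X L.
  split=> [/(has_inc_rev (M := m.*2.+1)) inc|]; last exact: has_inc_rev.
  apply: eq_has_inc (inc _) => p pm; last by rewrite leq_subr.
  by rewrite /X' -/(rev p) revK //; have := XM _ pm; lia.
move=> ->; rewrite /X' revK //; have := XM _ im; rewrite /rev; lia.
Qed.

(** * From chains to LIS of input tuples *)

(** A zero can only start a chain, so a chain of length at least 2 avoids the tail; a single tail
    position is traded for position 0. *)
Lemma has_inc_tail m n X L :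
  0 < m -> m <= n -> (forall p, m <= p -> X p = 0) ->
  has_inc n X L <-> has_inc m X L.
Proof.
move=> m0 mn X0; split=> -[T [Tn Ts LT]]; last first.
  by exists T; split=> //; apply: sub_all Tn => p /=; lia.
have step p q : chain_rel X p q -> q < m.
  by case/andP=> _; case: (ltnP q m) => // /X0 ->; rewrite ltn0.
case: T Tn Ts LT => [|p [|q T]] /= Tn Ts LT.
- by exists [::].
- by exists [:: 0]; rewrite /= m0.
have pm : p < m.
  rewrite ltnNge; apply/negP => mp; move: (Ts) => /andP[pq _].
  have := step _ _ pq; case/andP: pq; lia.
exists [:: p, q & T]; split=> //; rewrite [all _ _]/= pm.
move: Ts; rewrite -[_ && _]/(path (chain_rel X) p (q :: T)).
rewrite -[true && _]/(all (fun p => p < m) (q :: T)).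
elim: (q :: T) p {pm Tn LT} => //= y s IH p /andP[py /IH ->].
by rewrite andbT; apply: step py.
Qed.

Lemma tval_mktuple_nat (T : Type) (g : nat -> T) n :
  tval [tuple g i | i < n] = map g (iota 0 n).
Proof. by rewrite /= -val_enum_ord -map_comp. Qed.

Lemma LIS_has_inc (d : Order.disp_t) (Sigma : orderType d) n
    (s : nat -> Sigma) (X : nat -> nat) L :
  (forall a b, a <= n -> b <= n -> (s a < s b)%O = (a < b)) ->
  (forall p, p < n -> X p <= n) ->
  L <= LIS [tuple s (X i) | i < n] <-> has_inc n X L.
Proof.
move=> smono Xn.
have maskE (mk : seq bool) : mask mk [tuple s (X i) | i < n] =
    map (s \o X) (mask mk (iota 0 n)).
  by rewrite map_mask (tval_mktuple_nat (s \o X)).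
have sortE T : sorted ltn T -> all (fun p => p < n) T ->
    sorted <%O (map (s \o X) T) = sorted (chain_rel X) T.
  move=> Ts Tn; rewrite sorted_map.
  elim: T Ts Tn => //= p [|q T] //= IH /andP[pq Ts] /and3P[pn qn Tn].
  by rewrite IH ?qn // /chain_rel pq smono ?Xn.
split.
  case: (posnP L) => [-> _|L0 LX]; first by exists [::].
  have [mk mks Lm] : exists2 mk : n.-tuple bool,
      sorted <%O (mask mk [tuple s (X i) | i < n]) &
      L <= size (mask mk [tuple s (X i) | i < n]).
    apply/exists_inP; apply: contraTT LX.
    rewrite negb_exists_in => /forall_inP H.
    by rewrite -ltnNge -(ltn_predK L0) ltnS; apply/bigmax_leqP => mk /H; lia.
  move: mks Lm; rewrite maskE size_map => mks Lm.
  have Tn : all (fun p => p < n) (mask mk (iota 0 n)).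
    by apply/allP => p /mem_mask; rewrite mem_iota.
  have Ts : sorted ltn (mask mk (iota 0 n)).
    by apply: sorted_mask (iota_ltn_sorted 0 n); exact: ltn_trans.
  by exists (mask mk (iota 0 n)); rewrite -sortE.
move=> [T [Tn Ts LT]].
have Tl : sorted ltn T by apply: sub_sorted Ts => p q /andP[].
pose mk := [tuple (i : nat) \in T | i < n].
have mkE : mask mk (iota 0 n) = T.
  rewrite (tval_mktuple_nat (fun i => i \in T)) -filter_mask.
  apply: (irr_sorted_eq ltn_trans ltnn) => //.
    by apply: sorted_filter (iota_ltn_sorted 0 n); exact: ltn_trans.
  move=> p; rewrite mem_filter mem_iota /=; apply: andb_idr.
  by move/(allP Tn).
apply: leq_trans LT _; rewrite -{1}mkE -(size_map (s \o X)) -maskE.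
apply: (leq_bigmax_cond (F := fun mk : n.-tuple bool =>
  size (mask mk [tuple s (X i) | i < n]))).
by rewrite maskE mkE sortE.
Qed.

(** With [U = predT] this is a hard input; a smaller [U] keeps only part of it and lets [w] fill the
    rest. *)
Definition probe (m : nat) (U : pred nat) (w : nat -> nat) (b : nat -> bool)
    (p : nat) : nat :=
  if m <= p then 0 else if U p then (b p + p.*2).+1 else w p.

Lemma LIS_separates (d : Order.disp_t) (Sigma : orderType d) (n m : nat)
    (s : nat -> Sigma) (U : pred nat) (b b' : nat -> bool) (i : nat) :
  (forall x y, x <= n -> y <= n -> (s x < s y)%O = (x < y)) ->
  m.*2 <= n -> i < m -> U i -> (cnt U m).*2 <= m -> b i != b' i ->
  exists w, LIS [tuple s (probe m U w b j) | j < n] <>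
            LIS [tuple s (probe m U w b' j) | j < n].
Proof.
move=> smono mn im Ui Um bi.
have [w [L [e [wm H]]]] := detect im Ui Um.
have LISE (c : nat -> bool) :
    L <= LIS [tuple s (probe m U w c j) | j < n] <-> c i = e.
  rewrite (LIS_has_inc _ smono); last first.
    move=> p _; rewrite /probe; case: (leqP m p) => // pm.
    by case: (U p); [case: (c p); lia | have := wm _ pm; lia].
  rewrite (@has_inc_tail m) //; [|lia|lia|by move=> p mp; rewrite /probe mp].
  rewrite H; first 1 last.
  - by move=> p pm Up; rewrite /probe leqNgt pm Up; case: (c p); [right|left].
  - by move=> p pm Up; rewrite /probe leqNgt pm (negbTE Up).
  rewrite /probe leqNgt im Ui /=; case: (c i) e {H} => -[]; split; lia.
exists w => LL; move/eqP: bi; apply.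
have : b i = e <-> b' i = e by rewrite -!LISE LL.
by case: (b i) (b' i) e {H LISE} => -[] -[] [] h h' //;
  first [have := h erefl | have := h' erefl].
Qed.

(** * Cutting and comparing computations *)

(** The node [v] reached after [q1] is fixed before [z]: it depends only on the letters read so
    far. *)
Lemma computation_split (Sigma : Type) (n : nat) (Out : Type)
    (B : bprog Sigma n Out) (x : n.-tuple Sigma) (u : bp_node B) q1 q2 a :
  computation x u (q1 ++ q2) a ->
  exists v : bp_node B, forall (z : n.-tuple Sigma) q' a',
    {in q1, forall i, tnth z i = tnth x i} ->
    computation z u q' a' ->
    exists q3, q' = q1 ++ q3 /\ computation z v q3 a'.
Proof.
elim: q1 u => [|i q1 IH] u cx.
  by exists u => z q' a' _ cz; exists q'.
inversion cx as [|u' i' succ q a0 cu cx']; subst.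
have [v Hv] := IH _ cx'; exists v => z q' a' zx cz.
inversion cz as [u' a1 cu'|u' j succ' q a1 cu' cz']; subst.
  by rewrite cu in cu'.
move: cu'; rewrite cu => -[ij ss]; subst.
rewrite zx ?mem_head // in cz'.
have [|q3 [-> cv]] := Hv z q a' _ cz'; last by exists q3.
by move=> k k1; apply: zx; rewrite inE k1 orbT.
Qed.

(** Agreement is required only on indices queried by both runs: as long as the runs coincide, the
    next index lies in both lists. *)
Lemma computation_eq (Sigma : Type) (n : nat) (Out : Type)
    (B : bprog Sigma n Out) (x y : n.-tuple Sigma) (u : bp_node B) q q' a a' :
  {in q & q', forall i j, i = j -> tnth x i = tnth y j} ->
  computation x u q a -> computation y u q' a' -> a = a'.
Proof.
move=> xy cx; elim: cx q' xy => {u q a} [u a cu|u i succ q a cu cx IH] q' xy cy.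
  inversion cy as [u' a1 cu'|u' j succ' q1 a1 cu' cz']; subst.
    by move: cu'; rewrite cu => -[].
  by rewrite cu in cu'.
inversion cy as [u' a1 cu'|u' j succ' q1 a1 cu' cz']; subst.
  by rewrite cu in cu'.
move: cu'; rewrite cu => -[ij ss]; subst.
rewrite -(xy j j) ?mem_head // in cz'.
apply: IH cz' => k k' kq kq'; apply: xy; by rewrite inE ?kq ?kq' orbT.
Qed.

Lemma split_count (T : Type) (P : pred T) k (q : seq T) :
  k <= count P q -> exists q1 q2, q = q1 ++ q2 /\ count P q1 = k.
Proof.
elim: q k => [|x q IH] k /=.
  by rewrite leqn0 => /eqP ->; exists [::], [::].
case: k => [_|k]; first by exists [::], (x :: q).
case Px: (P x) => /= kq.
  move: kq; rewrite add1n ltnS => /IH[q1 [q2 [-> <-]]].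
  by exists (x :: q1), q2; rewrite /= Px.
have [q1 [q2 [-> e]]] := IH _ kq.
by exists (x :: q1), q2; rewrite /= Px.
Qed.

(** * Counting inputs per node, and the size bound *)

(** All members of a fiber agree with a fixed member [b] on [A b], so the fiber has at most
    [2 ^ (#|I| - k)] elements. *)
Lemma card_fibers (I V : finType) (k : nat) (f : {ffun I -> bool} -> V)
    (A : {ffun I -> bool} -> {set I}) :
  (forall b, #|A b| = k) ->
  (forall b b', f b = f b' -> {in A b, b =1 b'}) ->
  2 ^ k <= #|V|.
Proof.
move=> Ak fA.
have kI : k <= #|I| by rewrite -(Ak [ffun=> true]) max_card.
rewrite -(leq_pmul2r (expn_gt0 2 (#|I| - k))) -expnD subnKC //.
have -> : 2 ^ #|I| = \sum_(v : V) #|[set b | f b == v]|.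
  rewrite -card_bool -card_ffun -[LHS]sum1_card (partition_big f predT) //=.
  apply: eq_bigr => v _; rewrite -sum1_card; apply: eq_bigl => b.
  by rewrite inE.
rewrite -sum_nat_const; apply: leq_sum => v _.
case: (set_0Vmem [set b | f b == v]) => [-> | [b]]; first by rewrite cards0.
rewrite inE => /eqP fb.
pose F i := [pred c | (i \in A b) ==> (c == b i)].
have /leq_trans-> // : #|[set b | f b == v]| <= #|family F|.
  apply: subset_leq_card; apply/subsetP => b'; rewrite inE => /eqP fb'.
  apply/familyP => i; rewrite inE; apply/implyP => iA.
  by rewrite (fA b b') // fb.
rewrite card_family foldrE big_map big_enum /= (bigID (mem (A b))) /=.
rewrite big1 => [|i iA]; last first.
  by rewrite -(card1 (b i)); apply: eq_card => c; rewrite !inE iA.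
rewrite mul1n (eq_bigr (fun=> 2)) => [|i iA]; last first.
  by rewrite -card_bool; apply: eq_card => c; rewrite !inE (negbTE iA).
have -> : \prod_(i | i \notin A b) 2 = 2 ^ #|~: A b|.
  by rewrite -prod_nat_const; apply: eq_bigl => i; rewrite inE.
by rewrite cardsCs setCK Ak.
Qed.

Definition bits m (b : {ffun 'I_m -> bool}) (p : nat) : bool :=
  oapp b false (insub p).

Lemma bitsE m (b : {ffun 'I_m -> bool}) (i : 'I_m) : bits b i = b i.
Proof. by rewrite /bits valK. Qed.

Lemma cnt_mem_le n m (q : seq 'I_n) :
  cnt [in map val q] m <= count (fun i : 'I_n => i < m) q.
Proof.
rewrite -(count_map val (fun p => p < m)) /cnt -!size_filter.
apply: uniq_leq_size; first by rewrite filter_uniq ?iota_uniq.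
by move=> p; rewrite !mem_filter mem_iota /= => /andP[-> ->].
Qed.

Lemma cnt_predU (P Q : pred nat) m : cnt (predU P Q) m <= cnt P m + cnt Q m.
Proof. by rewrite /cnt -count_predUI leq_addr. Qed.

Lemma bp_size_LIS (n m k : nat) (d : Order.disp_t) (Sigma : orderType d)
    (B : bprog Sigma n nat) :
  m.*2 <= n -> (k.*2).*2 <= m ->
  has_more_than n Sigma -> read_once B -> bp_computes B (@LIS d Sigma n) ->
  2 ^ k <= bp_size B.
Proof.
move=> mn km [t [ut nt]] ro BL.
have [x0 _] : exists x0 : Sigma, true by case: t nt {ut} => // x0; exists x0.
pose s a := nth x0 (sort <=%O t) a.
have smono x y : x <= n -> y <= n -> (s x < s y)%O = (x < y).
  move=> xn yn; apply: (@lt_sorted_ltn_nth _ _ x0 (sort <=%O t)).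
  - by rewrite sort_lt_sorted.
  - by rewrite inE size_sort (leq_ltn_trans xn).
  - by rewrite inE size_sort (leq_ltn_trans yn).
pose inp (X : nat -> nat) := [tuple s (X j) | j < n].
have inp_eq (X Y : nat -> nat) (i : 'I_n) :
    X i = Y i -> tnth (inp X) i = tnth (inp Y) i.
  by move=> XY; rewrite !tnth_mktuple XY.
pose full b := probe m predT id b.
have probeE (U : pred nat) w (b b' : nat -> bool) p :
    U p \/ m <= p -> b p = b' p -> probe m U w b p = full b' p.
  by move=> Up bb'; rewrite /full /probe bb'; case: leqP Up => // _ [->|].
pose act := (fun i : 'I_n => i < m).
have reads_k (b : nat -> bool) q a :
    computation (inp (full b)) (bp_root B) q a -> k <= count act q.
  move=> cq; rewrite leqNgt; apply/negP => qk.
  have cqk := leq_ltn_trans (cnt_mem_le m q) qk.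
  (* Flipping the bit at an unread active [i] cannot change the output, yet [LIS_separates] says
     that it does. *)
  have [i im iq] : exists2 i, i \in iota 0 m & i \notin map val q.
    apply/allPn; rewrite all_count size_iota; apply/negbT/ltn_eqF.
    by apply: leq_trans cqk _; lia.
  rewrite mem_iota /= in im.
  pose U := predU (pred1 i) [in map val q].
  pose c p := b p (+) (p == i).
  have Ui : U i by rewrite /= eqxx.
  have Um : (cnt U m).*2 <= m.
    have i1 : cnt (pred1 i) m <= 1.
      by rewrite /cnt count_uniq_mem ?iota_uniq ?leq_b1.
    suff : cnt U m <= k by lia.
    apply: leq_trans (cnt_predU _ _ m) _.
    exact: leq_trans (leq_add i1 (leqnn _)) cqk.
  have [|w] := LIS_separates (b := b) (b' := c) smono mn im Ui Um.
    by rewrite /c eqxx; case: (b i).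
  apply.
  (* Splitting off an empty remainder makes [v] the final sink. *)
  rewrite -(cats0 q) in cq; have [v Hv] := computation_split cq.
  have [q3 [eq3 cv]] := Hv _ _ _ (fun _ _ => erefl) cq.
  have {eq3} q30 : q3 = [::].
    by move/eqP: eq3; rewrite eqseq_cat // => /andP[_ /eqP].
  have out (b' : nat -> bool) : {in q, forall j : 'I_n, b' j = b j} ->
      LIS (inp (probe m U w b')) = a.
    move=> bb'; have [q' cz] := BL (inp (probe m U w b')).
    have [j jq|q4 [_ cz']] := Hv _ _ _ _ cz; last first.
      by apply/esym/(computation_eq _ cv cz'); rewrite q30.
    apply: inp_eq; apply: probeE; last exact: bb'.
    by left; rewrite /= map_f ?orbT.
  rewrite (out b) ?(out c) // => j jq; rewrite /c.
  by case: eqP => [ji|]; [move: iq; rewrite -ji map_f | rewrite addbF].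
have split_b (b : {ffun 'I_m -> bool}) : exists vq : bp_node B * seq 'I_n,
    [/\ count act vq.2 = k, uniq vq.2 &
      forall z q' a',
        {in vq.2, forall i, tnth z i = tnth (inp (full (bits b))) i} ->
      computation z (bp_root B) q' a' ->
      exists q3, q' = vq.2 ++ q3 /\ computation z vq.1 q3 a'].
  have [q cq] := BL (inp (full (bits b))).
  have [q1 [q2 [e q1k]]] := split_count (reads_k _ _ _ cq).
  have uq := ro _ _ _ cq; rewrite e in cq uq.
  have [v Hv] := computation_split cq; exists (v, q1); split=> //.
  by move: uq; rewrite cat_uniq => /andP[].
have [vq Hvq] := fin_all_exists split_b.
pose A b := [set i : 'I_m | (i : nat) \in map val (vq b).2].
apply: (card_fibers (f := fun b => (vq b).1) (A := A)) => [b|b b' vv i].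
  (* Since the prefix has no repetition, its [k] active queries are [k] distinct positions. *)
  have [qk uq _] := Hvq b; rewrite -qk cardE -(size_map val).
  rewrite -(count_map val (fun p => p < m)) -size_filter; apply: perm_size.
  apply: uniq_perm => [||p].
  - by rewrite (map_inj_uniq val_inj) enum_uniq.
  - by rewrite filter_uniq // (map_inj_uniq val_inj).
  - rewrite mem_filter; apply/mapP/andP => [[j jA ->]|[pm pq]].
      by split; [exact: ltn_ord | move: jA; rewrite mem_enum inE].
    by exists (Ordinal pm); rewrite // mem_enum inE.
rewrite inE => iq; apply/eqP/negPn/negP => bi.
have [qk _ Hb] := Hvq b; have [qk' _ Hb'] := Hvq b'.
set q := (vq b).2 in iq qk Hb; set q' := (vq b').2 in qk' Hb'.
pose U := predU [in map val q] [in map val q'].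
(* [c] and [c'] keep the bits read in [q] and [q']. Off [q'], [c'] negates [b] rather than [b'], so
   that they differ at [i] even when [q'] misses [i]. *)
pose c p := if p \in map val q then bits b p else ~~ bits b p.
pose c' p := if p \in map val q' then bits b' p else ~~ bits b p.
have Um : (cnt U m).*2 <= m.
  suff : cnt U m <= k + k by lia.
  apply: leq_trans (cnt_predU _ _ m) _; rewrite -{1}qk -qk'.
  exact: leq_add (cnt_mem_le m q) (cnt_mem_le m q').
have [||w] := LIS_separates (b := c) (b' := c') smono mn (ltn_ord i) _ Um.
- by rewrite /= iq.
- rewrite /c /c' iq !bitsE.
  by case: ifP => _; [exact: bi | case: (b i)].
apply.
have [qX cX] := BL (inp (probe m U w c)).
have [qY cY] := BL (inp (probe m U w c')).
have [j jq|qX' [eX cX']] := Hb _ _ _ _ cX.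
  apply: inp_eq; apply: probeE; first by left; rewrite /= map_f.
  by rewrite /c map_f.
have [j jq|qY' [eY cY']] := Hb' _ _ _ _ cY.
  apply: inp_eq; apply: probeE; first by left; apply/orP; right; apply: map_f.
  by rewrite /c' map_f.
(* Both runs continue from the same node. By read-once, an index queried in both remainders is
   outside [q] and [q'], where both inputs carry [w] or 0. *)
rewrite -vv in cY'; apply: computation_eq cX' cY' => j j' jX jY jj'.
rewrite -{j'}jj' in jY *.
apply: inp_eq; rewrite /probe; case: leqP => // _.
have := ro _ _ _ cX; rewrite eX cat_uniq => /and3P[_ /hasPn /(_ j jX) jq _].
have := ro _ _ _ cY; rewrite eY cat_uniq => /and3P[_ /hasPn /(_ j jY) jq' _].
by rewrite /= !(mem_map val_inj) (negbTE jq) (negbTE jq').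
Qed.

Local Open Scope ring_scope.

Theorem theorem1 (R : realType) :
  exists2 c : R, 0 < c &
  exists n0 : nat,
    forall (n : nat) (d : Order.disp_t) (Sigma : orderType d)
           (B : bprog Sigma n nat),
      (n0 <= n)%N ->
      has_more_than n Sigma ->
      read_once B ->
      bp_computes B (@LIS d Sigma n) ->
      2 `^ (c * n%:R) <= (bp_size B)%:R.
Proof.
(* With [m = n./2] and [k = n %/ 8], rounding down costs at most a factor 2 once [8 <= n], so
   [n / 16 <= k]. *)
exists 16^-1; first by rewrite invr_gt0 ltr0n.
exists 8%N => n d Sigma B n8 Sn ro BL.
pose k := (n %/ 8)%N.
have kB : (2 ^ k <= bp_size B)%N.
  by apply: (bp_size_LIS (m := n./2) _ _ Sn ro BL); rewrite /k; lia.
apply: (@le_trans _ _ (2 ^+ k)); last by rewrite -natrX ler_nat.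
rewrite -powR_mulrn // ler_powR ?ler1n //.
rewrite mulrC ler_pdivrMr ?ltr0n // -natrM ler_nat /k; lia.
Qed.
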